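(* Let $T=[0,T_0]$ (with $T_0>0$) or $T=[0,\infty)$, and let $u,v$ be solutions to double-obstacle Allen--Cahn (AC) flow on $T$. Then for all $t\in T$ $$\|u(t)-v(t)\|_{\mathcal V}\le e^{t/\varepsilon}\|u(0)-v(0)\|_{\mathcal V}.$$
   Context: Let $G=(V,E)$ be a finite, undirected, simple, connected graph with symmetric weights $\omega_{ij}=\omega_{ji}$, $\omega_{ij}>0$ for $ij\in E$ and $\omega_{ij}=0$ for $ij\notin E$. Let $d_i=\sum_{j}\omega_{ij}>0$ be the degree of $i\in V$. Fix $r\in[0,1]$ and $\varepsilon>0$. Let $\mathcal V=\{u:V\to\mathbb R\}$ and, for $X\subseteq\mathbb R$, $\mathcal V_X=\{u:V\to X\}$; $\mathcal V$ carries the inner product $\langle u,v\rangle_{\mathcal V}=\sum_{i\in V}u_iv_id_i^r$ with norm $\|\cdot\|_{\mathcal V}$. $\mathbf 1\in\mathcal V$ is the constant function $1$. The graph Laplacian is $(\Delta u)_i=d_i^{-r}\sum_{j\in V}\omega_{ij}(u_i-u_j)$. For an open interval $T$, $H^1(T;\mathcal V)$ is the set of $u\in L^2(T;\mathcal V)$ with generalised (weak) time derivative $du/dt\in L^2(T;\mathcal V)$. For any interval $T$, $H^1_{loc}(T;\mathcal V)$ is the set of $u:T\to\mathcal V$ with $u\in H^1((a,b);\mathcal V)$ for all $a,b\in T$ with $a<b$. For $u\in\mathcal V_{[0,1]}$, $\mathcal B(u)$ is the set of $\alpha\in\mathcal V$ such that for each $i\in V$: $\alpha_i\ge0$ if $u_i=0$,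 $\alpha_i=0$ if $0<u_i<1$, and $\alpha_i\le0$ if $u_i=1$. A pair $(u,\beta)$ with $u:T\to\mathcal V_{[0,1]}$, $\beta:T\to\mathcal V$ is a solution to double-obstacle AC flow on an interval $T$ if $u\in H^1_{loc}(T;\mathcal V)\cap C^0(T;\mathcal V)$ and for a.e. $t\in T$, $\varepsilon\frac{du}{dt}+\varepsilon\Delta u(t)+\frac12\mathbf 1-u(t)=\beta(t)$ and $\beta(t)\in\mathcal B(u(t))$. One calls $u$ alone a solution if $(u,\beta)$ is a solution for some $\beta$. *)

(* Defs.v *)
From HB Require Import structures.
From mathcomp Require Import all_boot all_order all_algebra.
From mathcomp Require Import all_classical all_reals all_analysis.
Set Implicit Arguments.
Unset Strict Implicit.
Unset Printing Implicit Defensive.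
Import Order.TTheory GRing.Theory Num.Theory.
Import numFieldNormedType.Exports.
Local Open Scope classical_set_scope.
Local Open Scope ring_scope.

Definition degree (R : realType) (V : finType) (w : V -> V -> R) (i : V) : R :=
  \sum_(j : V) w i j.

Record weighted_graph (R : realType) (V : finType) := WeightedGraph {
  edge : rel V ;
  weight : V -> V -> R ;
  edge_sym : symmetric edge ;
  edge_irr : irreflexive edge ;
  edge_connected : forall i j : V, connect edge i j ;
  weight_sym : forall i j : V, weight i j = weight j i ;
  weight_edge : forall i j : V, edge i j -> 0 < weight i j ;
  weight_nonedge : forall i j : V, ~~ edge i j -> weight i j = 0 ;
  (* only excludes the graph with a single vertex *)
  degree_gt0 : forall i : V, 0 < degree weight i
}.

Section AllenCahn.
Variables (R : realType) (V : finType) (G : weighted_graph R V) (r eps : R).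

Local Notation mu := (@lebesgue_measure R).
Local Notation w := (weight G).
Local Notation d := (degree w).

Definition innerV (u v : V -> R) : R := \sum_(i : V) u i * v i * d i `^ r.

Definition normV (u : V -> R) : R := Num.sqrt (innerV u u).

Definition laplacian (u : V -> R) : V -> R :=
  fun i => d i `^ (- r) * \sum_(j : V) w i j * (u i - u j).

(* Time-dependent node functions on a set D of times are represented by total
   functions R -> V -> R; the predicates below only look at their values
   on D. *)

Definition deriv_t (phi : R -> V -> R) : R -> V -> R :=
  fun t i => derive1 (fun s => phi s i) t.

Definition L2 (D : set R) (u : R -> V -> R) : Prop :=
  (forall i, measurable_fun D (fun t => u t i)) /\
  (\int[mu]_(t in D) (normV (u t) ^+ 2)%:E < +oo)%E.

(* C_c^oo(D; V), each function being extended by 0 outside D *)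
Definition test_function (D : set R) (phi : R -> V -> R) : Prop :=
  let supp := closure [set t | exists i, phi t i != 0] in
  [/\ forall (i : V) (n : nat) (t : R),
        derivable (derive1n n (fun s => phi s i)) t 1,
      compact supp
    & supp `<=` D].

Definition weak_derivative (D : set R) (u du : R -> V -> R) : Prop :=
  forall phi, test_function D phi ->
    \int[mu]_(t in D) innerV (u t) (deriv_t phi t) =
    - \int[mu]_(t in D) innerV (du t) (phi t).

Definition H1_with (D : set R) (u du : R -> V -> R) : Prop :=
  [/\ L2 D u, L2 D du & weak_derivative D u du].

Definition H1 (D : set R) (u : R -> V -> R) : Prop :=
  exists du, H1_with D u du.

Definition H1_loc (T : set R) (u : R -> V -> R) : Prop :=
  forall a b, T a -> T b -> a < b -> H1 `]a, b[ u.

(* du is the generalised time derivative on the whole of T of u in H1_loc *)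
Definition time_derivative (T : set R) (u du : R -> V -> R) : Prop :=
  forall a b, T a -> T b -> a < b -> H1_with `]a, b[ u du.

Definition C0 (T : set R) (u : R -> V -> R) : Prop :=
  forall t, T t -> normV (u s - u t) @[s --> within T (nbhs t)] --> (0 : R).

Definition subdiffB (u : V -> R) : set (V -> R) :=
  [set alpha | forall i,
     [/\ u i = 0 -> 0 <= alpha i,
         0 < u i < 1 -> alpha i = 0
       & u i = 1 -> alpha i <= 0]].

Definition AC_solution_pair (T : set R) (u beta : R -> V -> R) : Prop :=
  [/\ forall t, T t -> forall i, 0 <= u t i <= 1,
      H1_loc T u,
      C0 T u
    & exists2 du, time_derivative T u du &
      \forall t \ae mu, T t ->
        (forall i, eps * du t i + eps * laplacian (u t) i + 2^-1 - u t i
                   = beta t i) /\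
        subdiffB (u t) (beta t)].

Definition AC_solution (T : set R) (u : R -> V -> R) : Prop :=
  exists beta, AC_solution_pair T u beta.

End AllenCahn.

(* Main.v *)
Require Import Defs.
From mathcomp Require Import all_boot all_order all_algebra.
From mathcomp Require Import all_classical all_reals all_analysis.
From mathcomp Require Import measurable_realfun.
From mathcomp Require Import ring lra.
Set Implicit Arguments.
Unset Strict Implicit.
Import Order.TTheory GRing.Theory Num.Theory.
Import numFieldNormedType.Exports.
Local Open Scope classical_set_scope.
Local Open Scope ring_scope.

(** Write w = u - v and F(t) = |w(t)|^2 in the norm of the node functions. At
    almost every time, subtracting the two equations and pairing with w gives
      eps <w', w> + eps <Delta w, w> - F = <beta_u - beta_v, w>,
    where <Delta w, w> >= 0 because the Laplacian is symmetric with nonnegative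
    weights [laplacian_ge0], and the right-hand side is <= 0 because beta is
    a normal force of an obstacle: where u_i < v_i, the node i cannot touch 1
    for u nor 0 for v, so beta_u >= 0 >= beta_v there [subdiffB_monotone].
    Hence <w', w> <= F / eps [AC_energy_ineq]; if F were differentiable with
    F' = 2 <w', w>, Gronwall's inequality would finish the proof.

    The time derivative is only a weak one, so two points need an argument.
    - The increment of <w, c>, for a constant vector c, is the integral of
      <w', c> [Rintegral_innerV_derivative]. It is obtained by testing the weak
      equation against smooth approximations of the indicator function of
      ]a, b[; continuity of w up to a and b recovers the boundary values
      [Rintegral_weak_derivative]. The approximations come from the flat
      function x |-> exp(-1/x).
    - No product rule is proved for F. With the constant vector
      c = w(b) + w(a) one has F(b) - F(a) = <w(b) - w(a), c>, which is the
      integral of <w', c>, and on a short interval c differs from 2 w(s) by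
      a uniformly small amount. So F(b) <= F(a) + (2/eps) F(a) (b - a) up to
      an error e (M(b) - M(a)) with M monotone and e arbitrarily small
      [energy_growth]. Summing over a fine subdivision and letting e tend to 0
      is a discrete Gronwall argument [le_expR_of_local_growth], which yields
      F(t) <= exp(2 t / eps) F(0); the claim is its square root. *)

(** * Smooth functions and a smooth step *)

(** The recursion peels derivatives from the inside, so that closure properties
    follow by induction on the order: the derivative of a product, composite
    or inverse is again built from functions derivable one time less. *)
Fixpoint ntimes_derivable {R : realType} (n : nat) (f : R -> R) : Prop :=
  if n is n'.+1 then (forall x, derivable f x 1) /\ ntimes_derivable n' (derive1 f)
  else True.

Definition smooth {R : realType} (f : R -> R) :=
  forall n, ntimes_derivable n f.

Section smooth.
Context {R : realType}.
Implicit Types f g df : R -> R.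

Lemma derive1_is_derive f df :
  (forall x : R, is_derive x 1 f (df x)) -> derive1 f = df.
Proof.
by move=> fdf; apply/funext => x; rewrite derive1E; case: (fdf x).
Qed.

Lemma ntimes_derivable_step n f df :
  (forall x : R, is_derive x 1 f (df x)) -> ntimes_derivable n df ->
  ntimes_derivable n.+1 f.
Proof.
move=> fdf ndf /=; rewrite (derive1_is_derive fdf).
by split=> // x; case: (fdf x).
Qed.

Lemma derivable_is_derive1 f : (forall x, derivable f x 1) ->
  forall x : R, is_derive x 1 f (derive1 f x).
Proof. by move=> df x; rewrite derive1E; exact: derivableP. Qed.

Lemma ntimes_derivableW n f : ntimes_derivable n.+1 f -> ntimes_derivable n f.
Proof.
elim: n f => [//|n IH] f [df ndf]; split => //; exact: IH.
Qed.

Lemma ntimes_derivable_cst n (c : R) : ntimes_derivable n (cst c).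
Proof.
elim: n c => [//|n IH] c.
by apply: (@ntimes_derivable_step _ _ (cst 0)); last exact: IH.
Qed.

Lemma ntimes_derivableD n f g : ntimes_derivable n f -> ntimes_derivable n g ->
  ntimes_derivable n (fun x => f x + g x).
Proof.
elim: n f g => [//|n IH] f g [df nf] [dg ng].
apply: (@ntimes_derivable_step _ _ (fun x => derive1 f x + derive1 g x)); last exact: IH.
move=> x; have ? := derivable_is_derive1 df x.
by have ? := derivable_is_derive1 dg x; exact: is_deriveD.
Qed.

Lemma ntimes_derivableM n f g : ntimes_derivable n f -> ntimes_derivable n g ->
  ntimes_derivable n (fun x => f x * g x).
Proof.
elim: n f g => [//|n IH] f g nf ng.
apply: (@ntimes_derivable_step _ _ (fun x => f x * derive1 g x + g x * derive1 f x)).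
  move=> x; have ? := derivable_is_derive1 nf.1 x.
  by have ? := derivable_is_derive1 ng.1 x; exact: is_deriveM.
apply: ntimes_derivableD; apply: IH;
  by [exact: ntimes_derivableW|exact: nf.2|exact: ng.2].
Qed.

Lemma ntimes_derivable_affine n f (p q : R) : ntimes_derivable n f ->
  ntimes_derivable n (fun x => f (p * x + q)).
Proof.
elim: n f => [//|n IH] f [df nf].
apply: (@ntimes_derivable_step _ _ (fun x => (derive1 f) (p * x + q) * p)).
  move=> x; apply: is_derive1_comp; first exact: derivable_is_derive1.
  have := is_deriveD (is_deriveZ p (is_derive_id x 1)) (is_derive_cst q x 1).
  by rewrite addr0 /GRing.scale/= mulr1.
apply: ntimes_derivableM; last exact: ntimes_derivable_cst.
exact: IH.
Qed.

Lemma ntimes_derivableV n f : (forall x, f x != 0) -> ntimes_derivable n f ->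
  ntimes_derivable n (fun x => (f x)^-1).
Proof.
move=> f0; elim: n => [//|n IH] nf.
have nV := IH (ntimes_derivableW nf).
apply: (@ntimes_derivable_step _ _ (fun x => (-1 * (f x)^-1 * (f x)^-1) * derive1 f x)).
  move=> x; have ? := derivable_is_derive1 nf.1 x.
  have := is_deriveV (f0 x) (derivable_is_derive1 nf.1 x).
  suff -> : - f x ^- 2 *: derive1 f x =
    -1 * (f x)^-1 * (f x)^-1 * derive1 f x by [].
  by rewrite /GRing.scale/= expr2 invfM; ring.
apply: ntimes_derivableM nf.2.
apply: (ntimes_derivableM _ nV).
apply: (ntimes_derivableM _ nV).
exact: ntimes_derivable_cst.
Qed.

Lemma smooth_derivable f : smooth f -> forall n x, derivable (derive1n n f) x 1.
Proof.
move=> sf n; move: (sf n.+1); elim: n f {sf} => [f []//|n IH f [_ nf]].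
by rewrite derive1Sn; exact: IH.
Qed.

(** The family f_n(x) = x^-n exp(-1/x), extended by 0 to x <= 0. It is closed
    under derivation up to linear combinations, f_n' = f_(n+2) - n f_(n+1),
    which makes all its members smooth at once. *)
Definition flat n (x : R) : R := if 0 < x then x^-1 ^+ n * expR (- x^-1) else 0.

Lemma flat_ge0 n x : 0 <= flat n x.
Proof.
rewrite /flat; case: ifPn => // x0.
by rewrite mulr_ge0 ?expR_ge0// exprn_ge0// invr_ge0 ltW.
Qed.

Lemma flat_le0 n x : x <= 0 -> flat n x = 0.
Proof. by rewrite /flat ltNge => ->. Qed.

Lemma flat_gt0 n x : 0 < x -> 0 < flat n x.
Proof.
by move=> x0; rewrite /flat x0 mulr_gt0 ?expR_gt0// exprn_gt0// invr_gt0.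
Qed.

(** exp(1/x) dominates the term of order n + 2 of its series, whence a zero of
    order two at the origin: this gives the derivative 0 there. *)
Lemma flat_quad n x : flat n x <= n.+2`!%:R * x ^+ 2.
Proof.
have [x0|x0] := leP x 0.
  by rewrite flat_le0// mulr_ge0// sqr_ge0.
rewrite /flat x0 expRN.
have xV : 0 < x^-1 by rewrite invr_gt0.
have /(le_trans _) E := expR_ge1Dxn n.+1 (ltW xV).
rewrite ler_pdivrMr ?expR_gt0//.
have F : x^-1 ^+ n.+2 / n.+2`!%:R <= expR x^-1.
  by apply: E; rewrite lerDr.
apply: le_trans (ler_wpM2l _ F); last by rewrite mulr_ge0// sqr_ge0.
rewrite le_eqVlt; apply/orP; left; apply/eqP.
rewrite [RHS](_ : _ = (x ^+ 2 * x^-1 ^+ n.+2) * (n.+2`!%:R / n.+2`!%:R)); last first.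
  by ring.
rewrite divff ?pnatr_eq0 -?lt0n ?fact_gt0// mulr1 !exprS.
by move: (x^-1 ^+ n) => z; field; rewrite gt_eqF.
Qed.

Lemma is_derive_flat n (x : R) :
  is_derive x 1 (flat n) (flat n.+2 x - n%:R * flat n.+1 x).
Proof.
have [x0|x0|->] := ltgtP x 0.
- rewrite !flat_le0 ?(ltW x0)// mulr0 subr0.
  apply: (near_eq_is_derive (f := cst 0)).
  near=> y; rewrite flat_le0// ltW//; near: y.
  exact: lt_nbhsl.
- have dV : is_derive x 1 (fun y : R => y^-1) (- x ^- 2).
    have /= := @is_deriveV R id x 1 1 (lt0r_neq0 x0) (is_derive_id x 1).
    by rewrite /GRing.scale/= mulr1.
  apply: (@near_eq_is_derive R R^o R^o (fun y : R => y^-1 ^+ n * expR (- y^-1))).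
    near=> y; rewrite /flat ifT//; near: y.
    exact: lt_nbhsr.
  have dE : is_derive x 1 (fun y => expR (- y^-1)) (expR (- x^-1) * x ^- 2).
    have := @is_derive1_comp R expR (fun y => - y^-1) x _ _ (is_derive_expR _) (is_deriveN dV).
    by rewrite opprK.
  have dX := is_deriveX n dV.
  rewrite (_ : _ ^+ n = (fun y => y^-1 ^+ n)) in dX; last by rewrite exprfctE.
  apply: (is_derive_eq (is_deriveM dX dE)).
  rewrite /GRing.scale/= /flat x0 -exprVn !exprS expr0.
  case: n {dX} => [|n]; first by rewrite !expr0; ring.
  by rewrite -mulr_natl/= !exprS; ring.
- rewrite !flat_le0// mulr0 subr0.
  (* the difference quotient at 0 is O(h) by the quadratic bound *)
  have L : h^-1 *: ((flat n \o shift 0) (h *: 1) - flat n 0) @[h --> (0:R)^'] --> (0:R).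
    apply/cvgr0Pnorm_le => e e0.
    have C0 : 0 < n.+2`!%:R :> R by rewrite ltr0n fact_gt0.
    near=> h.
    have h0 : h != 0 by near: h; exact: nbhs_dnbhs_neq.
    rewrite (@flat_le0 n 0)// subr0 /= addr0 [h *: 1]mulr1 normrM normfV.
    rewrite ler_pdivrMl ?normr_gt0// ger0_norm ?flat_ge0//.
    apply: le_trans (flat_quad _ _) _.
    rewrite -real_normK ?num_real// expr2 mulrCA ler_wpM2l// -ler_pdivlMl//.
    rewrite mulrC; near: h; apply: dnbhs0_le; exact: divr_gt0.
  have D : derivable (flat n) 0 1 by apply/cvg_ex; exists 0.
  by apply: DeriveDef => //; exact: cvg_lim.
Unshelve. all: by end_near. Qed.

Lemma ntimes_derivable_flat k n : ntimes_derivable k (flat n).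
Proof.
elim: k n => [//|k IH] n.
apply: (ntimes_derivable_step (is_derive_flat n)).
apply: ntimes_derivableD; first exact: IH.
rewrite (_ : (fun x => _) = (fun x => (- n%:R) * flat n.+1 x)); last first.
  by apply/funext => x; rewrite mulNr.
by apply: ntimes_derivableM; [exact: ntimes_derivable_cst|exact: IH].
Qed.

Definition step_denominator (x : R) := flat 0 x + flat 0 (1 - x).

(** The denominator never vanishes, since x and 1 - x are not both
    nonpositive; the quotient goes smoothly from 0 (for x <= 0) to 1
    (for x >= 1). *)
Definition smooth_step (x : R) := flat 0 x / step_denominator x.

Lemma step_denominator_gt0 x : 0 < step_denominator x.
Proof.
rewrite /step_denominator; have [x0|x0] := ltP 0 x.
  by rewrite ltr_wpDr ?flat_ge0// flat_gt0.
by rewrite ltr_wpDl ?flat_ge0// flat_gt0//; lra.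
Qed.

Lemma smooth_smooth_step : smooth smooth_step.
Proof.
move=> n; have nf := ntimes_derivable_flat n 0.
apply: ntimes_derivableM => //; apply: ntimes_derivableV.
  by move=> x; rewrite gt_eqF// step_denominator_gt0.
apply: ntimes_derivableD => //.
rewrite (_ : (fun x => _) = (fun x => flat 0 (-1 * x + 1))); last first.
  by apply/funext => x; rewrite mulN1r addrC.
exact: ntimes_derivable_affine.
Qed.

Lemma smooth_step_le0 x : x <= 0 -> smooth_step x = 0.
Proof. by move=> x0; rewrite /smooth_step flat_le0// mul0r. Qed.

Lemma smooth_step_ge1 x : 1 <= x -> smooth_step x = 1.
Proof.
move=> x1; rewrite /smooth_step /step_denominator (@flat_le0 0 (1 - x)) ?subr_le0//.
by rewrite addr0 divff// gt_eqF// flat_gt0//; exact: lt_le_trans x1.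
Qed.

Lemma smooth_step_itv x : 0 <= smooth_step x <= 1.
Proof.
rewrite /smooth_step divr_ge0 ?flat_ge0// ?(ltW (step_denominator_gt0 _))//=.
by rewrite ler_pdivrMr ?step_denominator_gt0// mul1r lerDl flat_ge0.
Qed.

(** The explicit form of the derivative of the step makes both its sign and
    its vanishing outside ]0, 1[ visible. *)
Definition smooth_step_slope (x : R) :=
  (flat 2 x * flat 0 (1 - x) + flat 0 x * flat 2 (1 - x)) /
  step_denominator x ^+ 2.

Lemma is_derive_smooth_step (x : R) :
  is_derive x 1 smooth_step (smooth_step_slope x).
Proof.
have df (y : R) : is_derive y 1 (flat 0) (flat 2 y).
  by have := is_derive_flat 0 y; rewrite mul0r subr0.
have dB : is_derive x 1 (fun y : R => 1 - y) (-1).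
  have := is_deriveB (is_derive_cst (1 : R) x 1) (is_derive_id x 1).
  by rewrite sub0r.
have dr : is_derive x 1 (flat 0 \o (fun y => 1 - y)) (flat 2 (1 - x) * -1).
  exact: is_derive1_comp.
have dd := is_deriveD (df x) dr.
have D0 : step_denominator x != 0 by rewrite gt_eqF// step_denominator_gt0.
have := is_deriveM (df x) (is_deriveV (f := step_denominator) D0 dd).
rewrite (_ : _ + _ = smooth_step_slope x)//.
rewrite /smooth_step_slope /GRing.scale/=.
by move: D0; rewrite /step_denominator => D0; field.
Qed.

Lemma smooth_step_slope_ge0 x : 0 <= smooth_step_slope x.
Proof.
by rewrite /smooth_step_slope divr_ge0 ?sqr_ge0// addr_ge0// mulr_ge0// flat_ge0.
Qed.

Lemma smooth_step_slope_out x : x \notin `]0, 1[ -> smooth_step_slope x = 0.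
Proof.
rewrite in_itv/= negb_and -!leNgt => /orP[] x01; rewrite /smooth_step_slope.
  by rewrite !(@flat_le0 _ x)// !mul0r addr0 mul0r.
by rewrite !(@flat_le0 _ (1 - x)) ?subr_le0// !mulr0 addr0 mul0r.
Qed.

End smooth.

(** * Integrability on bounded intervals and ramps *)

Section ramp.
Context {R : realType}.
Implicit Types f g : R -> R.
Local Notation mu := (@lebesgue_measure R).

Lemma smooth_derive1 f : smooth f -> smooth (derive1 f).
Proof. by move=> sf n; have [] := sf n.+1. Qed.

Lemma smooth_continuous f : smooth f -> continuous f.
Proof.
move=> sf x; apply: differentiable_continuous; apply/derivable1_diffP.
exact: (sf 1).1.
Qed.

Lemma smoothB f g : smooth f -> smooth g -> smooth (fun x => f x - g x).
Proof.
move=> sf sg n; apply: ntimes_derivableD => //.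
rewrite (_ : (fun x => _) = (fun x => -1 * g x)); last first.
  by apply/funext => x; rewrite mulN1r.
by apply: ntimes_derivableM => //; exact: ntimes_derivable_cst.
Qed.

Lemma continuous_integrable_itvoo (a b : R) f : continuous f ->
  mu.-integrable `]a, b[ (EFin \o f).
Proof.
move=> cf; have : mu.-integrable `[a, b] (EFin \o f).
  apply: continuous_compact_integrable; first exact: segment_compact.
  exact: continuous_subspaceT.
by apply: integrableS => //; exact: subset_itv_oo_cc.
Qed.

Lemma integrable_addr (D : set R) f g : measurable D ->
  mu.-integrable D (EFin \o f) -> mu.-integrable D (EFin \o g) ->
  mu.-integrable D (EFin \o (fun x => f x + g x)).
Proof. by move=> mD fi gi; exact: (@integrableD _ _ R mu D mD _ _ fi gi). Qed.

Lemma integrable_subr (D : set R) f g : measurable D ->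
  mu.-integrable D (EFin \o f) -> mu.-integrable D (EFin \o g) ->
  mu.-integrable D (EFin \o (fun x => f x - g x)).
Proof. by move=> mD fi gi; exact: (@integrableB _ _ R mu D mD _ _ fi gi). Qed.

Lemma integrable_scaler (D : set R) (k : R) f : measurable D ->
  mu.-integrable D (EFin \o f) -> mu.-integrable D (EFin \o (fun x => k * f x)).
Proof. by move=> mD fi; exact: (@integrableZl _ _ R mu D mD k _ fi). Qed.

Lemma integrable_normr (D : set R) f : measurable D ->
  mu.-integrable D (EFin \o f) -> mu.-integrable D (EFin \o (fun x => `|f x|)).
Proof. by move=> mD fi; exact: (@integrable_norm _ _ R mu D _ fi). Qed.

Lemma integrable_sumr (I : Type) (s : seq I) (D : set R) (F : I -> R -> R) :
  measurable D -> (forall i, mu.-integrable D (EFin \o F i)) ->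
  mu.-integrable D (EFin \o (fun x => \sum_(i <- s) F i x)).
Proof.
move=> mD Fi; elim: s => [|i s IH].
  rewrite (_ : _ \o _ = cst 0%E); last by apply/funext => x; rewrite /= big_nil.
  exact: integrable0.
rewrite (_ : _ \o _ = EFin \o (fun x => F i x + \sum_(j <- s) F j x)).
  exact: integrable_addr.
by apply/funext => x; rewrite /= big_cons.
Qed.

Lemma integrable_mul_bounded (D : set R) (M : R) f g :
  measurable D -> mu.-integrable D (EFin \o f) -> measurable_fun D g ->
  (forall x, D x -> `|g x| <= M) -> mu.-integrable D (EFin \o (fun x => f x * g x)).
Proof.
move=> mD intf mg gM; have intMf := @integrableZl _ _ R mu D mD M _ intf.
apply: le_integrable intMf => //.
- apply/measurable_EFinP; apply: measurable_funM => //.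
  by apply/measurable_EFinP; exact: measurable_int intf.
- move=> x Dx; rewrite /= lee_fin !normrM mulrC.
  by rewrite ler_wpM2r// (le_trans (gM _ Dx))// ler_norm.
Qed.

Lemma integrable_mul_continuous (a b : R) f g : a < b ->
  mu.-integrable `]a, b[ (EFin \o f) -> continuous g ->
  mu.-integrable `]a, b[ (EFin \o (fun x => f x * g x)).
Proof.
move=> ab intf cg.
have cng : {within `[a, b], continuous (fun x => `|g x|)}.
  apply: continuous_subspaceT => x.
  by apply: continuous_comp; [exact: cg|exact: norm_continuous].
have [c _ cmax] := EVT_max (ltW ab) cng.
apply: (@integrable_mul_bounded _ `|g c|) => //.
- apply: measurable_funTS; exact: continuous_measurable_fun.
- by move=> x /= xab; apply: cmax; exact: subset_itv_oo_cc.
Qed.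

(** The smooth step rescaled to climb from 0 to 1 on [c, c + h]. *)
Definition ramp (c h x : R) := smooth_step (h^-1 * x - h^-1 * c).

Lemma smooth_ramp c h : smooth (ramp c h).
Proof. by move=> n; apply: ntimes_derivable_affine; exact: smooth_smooth_step. Qed.

Lemma derive1_ramp c h :
  derive1 (ramp c h) = fun x => smooth_step_slope (h^-1 * x - h^-1 * c) * h^-1.
Proof.
apply: derive1_is_derive => x; apply: is_derive1_comp.
  exact: is_derive_smooth_step.
have := is_deriveB (is_deriveZ h^-1 (is_derive_id x 1)) (is_derive_cst (h^-1 * c) x 1).
by rewrite subr0 /GRing.scale/= mulr1.
Qed.

Lemma ramp_le0 c h x : 0 < h -> x <= c -> ramp c h x = 0.
Proof.
move=> h0 xc; rewrite /ramp smooth_step_le0// -mulrBr.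
by rewrite pmulr_rle0 ?invr_gt0// subr_le0.
Qed.

Lemma ramp_ge1 c h x : 0 < h -> c + h <= x -> ramp c h x = 1.
Proof.
move=> h0 xc; rewrite /ramp smooth_step_ge1// -mulrBr.
by rewrite ler_pdivlMl// mulr1 lerBrDl.
Qed.

Lemma ramp_itv c h x : 0 <= ramp c h x <= 1.
Proof. exact: smooth_step_itv. Qed.

Lemma derive1_ramp_ge0 c h x : 0 < h -> 0 <= derive1 (ramp c h) x.
Proof.
by move=> h0; rewrite derive1_ramp mulr_ge0 ?smooth_step_slope_ge0// invr_ge0 ltW.
Qed.

Lemma derive1_ramp_out c h x : 0 < h -> x \notin `]c, c + h[ ->
  derive1 (ramp c h) x = 0.
Proof.
move=> h0 xc; rewrite derive1_ramp smooth_step_slope_out ?mul0r//.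
apply: contra xc; rewrite !in_itv/= -mulrBr pmulr_rgt0 ?invr_gt0// subr_gt0.
by rewrite ltr_pdivrMl// mulr1 ltrBlDl.
Qed.

Lemma Rintegral_derive1_smooth (a b : R) f : a < b -> smooth f ->
  \int[mu]_(x in `]a, b[) derive1 f x = f b - f a.
Proof.
move=> ab sf; have cf := smooth_continuous sf.
have cdf := smooth_continuous (smooth_derive1 sf).
rewrite /Rintegral -(@integral_itv_bndoo R a b _ true false); last first.
  apply/measurable_EFinP; apply: measurable_funTS; exact: continuous_measurable_fun.
rewrite (@continuous_FTC2 _ _ f)//.
- exact: continuous_subspaceT.
- split.
  + by move=> x _; exact: (sf 1).1.
  + by apply: cvg_at_right_filter; exact: cf.
  + by apply: cvg_at_left_filter; exact: cf.
Qed.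

(** The slope of a ramp is a probability density carried by ]c, c + h[, so
    integrating g against it averages g over that interval. *)
Lemma Rintegral_ramp_mean (a b c h g0 eta : R) g :
  0 < h -> a <= c -> c + h <= b ->
  mu.-integrable `]a, b[ (EFin \o g) ->
  (forall x, c < x < c + h -> `|g x - g0| <= eta) ->
  `|\int[mu]_(x in `]a, b[) (g x * derive1 (ramp c h) x) - g0| <= eta.
Proof.
move=> h0 ac cb intg gc.
have ab : a < b by lra.
set K := derive1 (ramp c h).
have cK : continuous K by apply/smooth_continuous/smooth_derive1/smooth_ramp.
have intK1 : \int[mu]_(x in `]a, b[) K x = 1.
  rewrite Rintegral_derive1_smooth//; last exact: smooth_ramp.
  by rewrite ramp_ge1// ramp_le0// subr0.
have int_cst (r : R) : mu.-integrable `]a, b[ (EFin \o (cst r)).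
  by apply: continuous_integrable_itvoo => x; exact: cst_continuous.
have intK (r : R) : mu.-integrable `]a, b[ (EFin \o (fun x => r * K x)).
  exact: (@integrable_mul_continuous a b (cst r)).
have intgK := integrable_mul_continuous ab intg cK.
have iK : mu.-integrable `]a, b[ (EFin \o K).
  by have := intK 1; congr (_.-integrable _ _); apply/funext => x /=; rewrite mul1r.
have lin (r : R) : \int[mu]_(x in `]a, b[) (r * K x) = r.
  by rewrite RintegralZl// intK1 mulr1.
(* g0 is the integral of g0 K, so only (g - g0) K is left to bound *)
rewrite -[X in _ - X]lin -RintegralB//.
rewrite (le_trans (le_normr_Rintegral _ _))//.
  exact: integrable_subr.
rewrite -[leRHS]lin; apply: le_Rintegral => //.
  exact: integrable_normr (integrable_subr _ _ _).
move=> x _; rewrite -mulrBl normrM.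
have [xc|xc] := boolP (x \in `]c, c + h[).
  rewrite (ger0_norm (derive1_ramp_ge0 _ _ _))// ler_wpM2r//.
    exact: derive1_ramp_ge0.
  by apply: gc; move: xc; rewrite in_itv.
by rewrite /K derive1_ramp_out// normr0 !mulr0.
Qed.

End ramp.

(** * The fundamental theorem of calculus for weak derivatives *)

Section weak.
Context {R : realType}.
Implicit Types f g : R -> R.
Local Notation mu := (@lebesgue_measure R).

Lemma derive1B_smooth f g : smooth f -> smooth g ->
  derive1 (fun x => f x - g x) = fun x => derive1 f x - derive1 g x.
Proof.
move=> sf sg; apply: derive1_is_derive => x.
have df := derivable_is_derive1 (sf 1).1 x.
have dg := derivable_is_derive1 (sg 1).1 x.
exact: is_deriveB.
Qed.

Section cutoff.
Variables (a b : R).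
Hypothesis ab : a < b.

(** Four widths must fit in b - a: the cutoff vanishes on one width at each end
    of ]a, b[ and uses a second one to climb or descend. *)
Definition cutoff_width (n : nat) : R := (b - a) / n.+4%:R.

Definition cutoff (n : nat) (x : R) : R :=
  let h := cutoff_width n in ramp (a + h) h x - ramp (b - 2 * h) h x.

Lemma cutoff_width_gt0 n : 0 < cutoff_width n.
Proof. by rewrite divr_gt0// subr_gt0. Qed.

Lemma cutoff_width4 n : 4 * cutoff_width n <= b - a.
Proof.
rewrite /cutoff_width mulrCA ger_pMr ?subr_gt0//.
by rewrite ler_pdivrMr// mul1r ler_nat.
Qed.

Lemma cutoff_width_lt (d : R) : 0 < d -> \forall n \near \oo, cutoff_width n < d.
Proof.
move=> d0; have e0 : 0 < d / (b - a) by rewrite divr_gt0// subr_gt0.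
have := near_infty_natSinv_lt (PosNum e0).
apply: filterS => n /= nd.
rewrite /cutoff_width mulrC -ltr_pdivlMr ?subr_gt0//.
by apply: le_lt_trans nd; rewrite lef_pV2 ?posrE// ler_nat ltnS -addn3 leq_addr.
Qed.

Lemma smooth_cutoff n : smooth (cutoff n).
Proof. by apply: smoothB; exact: smooth_ramp. Qed.

Lemma cutoff_support n x : cutoff n x != 0 ->
  a + cutoff_width n <= x <= b - cutoff_width n.
Proof.
have h0 := cutoff_width_gt0 n; have h4 := cutoff_width4 n.
rewrite /cutoff; apply: contraR; rewrite negb_and -!ltNge => /orP[] hx.
  by rewrite !ramp_le0 ?subr0//; lra.
by rewrite !ramp_ge1 ?subrr//; lra.
Qed.

Lemma cutoff_eq1 n x :
  a + 2 * cutoff_width n <= x <= b - 2 * cutoff_width n -> cutoff n x = 1.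
Proof.
have h0 := cutoff_width_gt0 n.
by move=> xab; rewrite /cutoff ramp_ge1 ?ramp_le0 ?subr0//; lra.
Qed.

Lemma cutoff_norm_le1 n x : `|cutoff n x| <= 1.
Proof.
rewrite /cutoff ler_norml.
have := ramp_itv (a + cutoff_width n) (cutoff_width n) x.
have := ramp_itv (b - 2 * cutoff_width n) (cutoff_width n) x.
lra.
Qed.

Lemma cvg_Rintegral_cutoff f : mu.-integrable `]a, b[ (EFin \o f) ->
  \int[mu]_(x in `]a, b[) (f x * cutoff n x) @[n --> \oo] -->
  \int[mu]_(x in `]a, b[) f x.
Proof.
move=> intf; apply: fine_cvg; rewrite fineK; last first.
  exact: (integrable_fin_num _ intf).
have mf : measurable_fun `]a, b[ f.
  by apply/measurable_EFinP; exact: measurable_int intf.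
apply: (@dominated_cvg _ _ R mu _ _ _ _ (EFin \o (fun x => `|f x|))) => //.
- move=> n; apply/measurable_EFinP; apply: measurable_funM => //.
  apply: measurable_funTS; apply: continuous_measurable_fun.
  exact/smooth_continuous/smooth_cutoff.
- move=> x /=; rewrite in_itv/= => /andP[ax xb].
  apply: cvg_near_cst.
  have d0 : 0 < Num.min (x - a) (b - x) / 2.
    by rewrite divr_gt0// lt_min !subr_gt0 ax.
  apply: filterS (cutoff_width_lt d0) => n.
  rewrite ltr_pdivlMr// lt_min => /andP[hx1 hx2].
  by rewrite cutoff_eq1 ?mulr1//; lra.
- exact: integrable_normr.
- move=> n x _; rewrite /= lee_fin normrM.
  by rewrite ler_piMr// cutoff_norm_le1.
Qed.

(** The derivative of the cutoff is an averaging density near a minus one near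
    b, so that the one-sided limits of g come out. *)
Lemma cvg_Rintegral_derive1_cutoff g (ga gb : R) :
  mu.-integrable `]a, b[ (EFin \o g) ->
  g x @[x --> a^'+] --> ga -> g x @[x --> b^'-] --> gb ->
  \int[mu]_(x in `]a, b[) (g x * derive1 (cutoff n) x) @[n --> \oo] -->
  ga - gb.
Proof.
move=> intg gaP gbP.
have split_int n : \int[mu]_(x in `]a, b[) (g x * derive1 (cutoff n) x) =
    \int[mu]_(x in `]a, b[)
      (g x * derive1 (ramp (a + cutoff_width n) (cutoff_width n)) x) -
    \int[mu]_(x in `]a, b[)
      (g x * derive1 (ramp (b - 2 * cutoff_width n) (cutoff_width n)) x).
  rewrite derive1B_smooth; [|exact: smooth_ramp|exact: smooth_ramp].
  rewrite -RintegralB//.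
  - by apply: eq_Rintegral => x _; rewrite mulrBr.
  - by apply: integrable_mul_continuous => //;
      exact/smooth_continuous/smooth_derive1/smooth_ramp.
  - by apply: integrable_mul_continuous => //;
      exact/smooth_continuous/smooth_derive1/smooth_ramp.
rewrite (_ : (fun n => _) = (fun n => \int[mu]_(x in `]a, b[)
      (g x * derive1 (ramp (a + cutoff_width n) (cutoff_width n)) x) -
    \int[mu]_(x in `]a, b[)
      (g x * derive1 (ramp (b - 2 * cutoff_width n) (cutoff_width n)) x))); last first.
  exact/funext.
apply: cvgB.
- apply/cvgrPdist_le => e e0.
  move/cvgrPdist_le : gaP => /(_ e e0) /nbhs_ballP[d /= d0 dP].
  have d20 : 0 < d / 2 by rewrite divr_gt0.
  apply: filterS (cutoff_width_lt d20) => n nd.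
  have h0 := cutoff_width_gt0 n; have h4 := cutoff_width4 n.
  rewrite distrC; apply: Rintegral_ramp_mean => //; [lra|lra|].
  move=> x xh; rewrite distrC; apply: dP; last lra.
  by rewrite /ball/= ltr_norml; lra.
- apply/cvgrPdist_le => e e0.
  move/cvgrPdist_le : gbP => /(_ e e0) /nbhs_ballP[d /= d0 dP].
  have d20 : 0 < d / 2 by rewrite divr_gt0.
  apply: filterS (cutoff_width_lt d20) => n nd.
  have h0 := cutoff_width_gt0 n; have h4 := cutoff_width4 n.
  rewrite distrC; apply: Rintegral_ramp_mean => //; [lra|lra|].
  move=> x xh; rewrite distrC; apply: dP; last lra.
  by rewrite /ball/= ltr_norml; lra.
Qed.

(** The fundamental theorem of calculus for weak derivatives: test with the
    cutoffs and let their width tend to 0 on both sides. *)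
Lemma Rintegral_weak_derivative g dg (ga gb : R) :
  mu.-integrable `]a, b[ (EFin \o g) -> mu.-integrable `]a, b[ (EFin \o dg) ->
  g x @[x --> a^'+] --> ga -> g x @[x --> b^'-] --> gb ->
  (forall phi a' b', smooth phi -> a < a' -> b' < b ->
    (forall x, phi x != 0 -> a' <= x <= b') ->
    \int[mu]_(x in `]a, b[) (g x * derive1 phi x) =
    - \int[mu]_(x in `]a, b[) (dg x * phi x)) ->
  \int[mu]_(x in `]a, b[) dg x = gb - ga.
Proof.
move=> intg intdg gaP gbP weak.
have L := cvg_Rintegral_derive1_cutoff intg gaP gbP.
rewrite (_ : (fun n => _) =
    (fun n => - \int[mu]_(x in `]a, b[) (dg x * cutoff n x))) in L; last first.
  apply/funext => n; have h0 := cutoff_width_gt0 n.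
  apply: (weak _ (a + cutoff_width n) (b - cutoff_width n)); [|lra|lra|].
  - exact: smooth_cutoff.
  - exact: cutoff_support.
have := cvg_unique _ L (cvgN (cvg_Rintegral_cutoff intdg)).
by move=> /(_ (@Rhausdorff R)) E; rewrite -[LHS]opprK -E opprB.
Qed.

End cutoff.
End weak.

(** * A Gronwall inequality and auxiliary real analysis *)

Section gronwall.
Context {R : realType}.
Local Notation mu := (@lebesgue_measure R).

(** Gronwall's inequality from an explicit Euler step, stable under an error
    e (M t - M s) that telescopes: along the subdivision j t0 / (n + 1) each step
    multiplies F by at most 1 + k h <= exp(k h), and the accumulated errors
    sum up to at most e (M t0 - M 0) exp(k t0). *)
Lemma le_expR_of_local_growth (k t0 : R) (F M : R -> R) :
  0 <= k -> 0 < t0 -> (forall t, 0 <= F t) ->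
  (forall s t, 0 <= s -> s <= t -> t <= t0 -> M s <= M t) ->
  (forall e, 0 < e -> exists2 d, 0 < d & forall s t,
     0 <= s -> s < t -> t <= t0 -> t - s < d ->
     F t <= F s + k * F s * (t - s) + e * (M t - M s)) ->
  F t0 <= expR (k * t0) * F 0.
Proof.
move=> k0 t00 F0 Mhomo growth.
have DM0 : 0 <= M t0 - M 0 by rewrite subr_ge0 Mhomo// ltW.
have approx e : 0 < e -> F t0 <= expR (k * t0) * (F 0 + e * (M t0 - M 0)).
  move=> e0; have [d d0 step] := growth _ e0.
  have [n nP] : exists n : nat, t0 / n.+1%:R < d.
    have [n _ /(_ n (leqnn n)) /= nP] :=
      near_infty_natSinv_lt (PosNum (divr_gt0 d0 t00)).
    by exists n; rewrite mulrC -ltr_pdivlMr.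
  set h := t0 / n.+1%:R in nP.
  have h0 : 0 < h by rewrite divr_gt0.
  have hn : n.+1%:R * h = t0 by rewrite /h mulrC divfK.
  suff H j : (j <= n.+1)%N ->
      F (j%:R * h) <= expR (k * (j%:R * h)) * (F 0 + e * (M (j%:R * h) - M 0)).
    by have := H _ (leqnn n.+1); rewrite hn.
  elim: j => [|j IH] jn; first by rewrite !mul0r mulr0 expR0 subrr mulr0 addr0 mul1r.
  have jhE : j.+1%:R * h = j%:R * h + h by rewrite -addn1 natrD mulrDl mul1r.
  have jh0 : 0 <= j%:R * h by rewrite mulr_ge0// ltW.
  have jt0 : j.+1%:R * h <= t0 by rewrite -hn ler_wpM2r ?(ltW h0)// ler_nat.
  have hE : j.+1%:R * h - j%:R * h = h by rewrite jhE addrC addKr.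
  have Fstep : F (j.+1%:R * h) <= F (j%:R * h) + k * F (j%:R * h) * h +
      e * (M (j.+1%:R * h) - M (j%:R * h)).
    have := step _ _ jh0 _ jt0; rewrite hE; apply => //.
    by rewrite jhE ltrDl.
  have MjS : M (j%:R * h) <= M (j.+1%:R * h) by apply: Mhomo => //; rewrite jhE lerDl ltW.
  have {}IH := IH (ltnW jn).
  apply: (le_trans Fstep).
  have E1 : 1 + k * h <= expR (k * h) := expR_ge1Dx _.
  have E2 : 1 <= expR (k * (j.+1%:R * h)).
    by rewrite -expR0 ler_expR !mulr_ge0// ltW.
  rewrite (_ : _ + k * _ * h = (1 + k * h) * F (j%:R * h)); last by ring.
  rewrite (_ : F 0 + e * (M (j.+1%:R * h) - M 0) = (F 0 + e * (M (j%:R * h) - M 0))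
     + e * (M (j.+1%:R * h) - M (j%:R * h))); last by ring.
  rewrite [leRHS]mulrDr lerD//; last first.
    by rewrite ler_peMl// mulr_ge0 ?(ltW e0)// subr_ge0.
  rewrite [in leRHS]jhE [k * (_ + h)]mulrDr expRD [expR _ * _]mulrC -mulrA.
  apply: ler_pM => //; first by rewrite addr_ge0// mulr_ge0// ltW.
apply/ler_addgt0Pr => e e0.
set E := expR (k * t0); have Epos : 0 < E by exact: expR_gt0.
(* the + 1 only keeps the denominator positive when M t0 = M 0 *)
have D1 : 0 < M t0 - M 0 + 1 by rewrite ltr_wpDl.
have e'0 : 0 < e / (E * (M t0 - M 0 + 1)) by rewrite divr_gt0// mulr_gt0.
apply: (le_trans (approx _ e'0)); rewrite mulrDr lerD2l -/E.
rewrite (_ : E * _ = e * ((M t0 - M 0) / (M t0 - M 0 + 1))); last first.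
  by field; rewrite !gt_eqF.
rewrite ler_piMr ?(ltW e0)// ler_pdivrMr// mul1r lerDl//.
Qed.

(** Heine's theorem for finitely many functions with a common modulus: the
    compact set is covered by balls on which every coordinate stays within
    e / 2 of its value at the centre. *)
Lemma uniform_continuity_compact (I : finType) (K : set R) (e : R)
    (f : R -> I -> R) :
  compact K -> 0 < e ->
  (forall t i, K t -> f s i @[s --> within K (nbhs t)] --> f t i) ->
  exists2 d, 0 < d & forall s t, K s -> K t -> `|s - t| < d ->
    forall i, `|f s i - f t i| <= e.
Proof.
move=> /compact_near_coveringP cK e0 cf; have e20 : 0 < e / 2 by rewrite divr_gt0.
have := cK R (0^'+) (fun d s => K s -> forall t, K t ->
  `|s - t| < d -> forall i, `|f s i - f t i| <= e) _.
case=> [x Kx|d /= d0 dP].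
  have : \forall y \near x, forall i, K y -> `|f x i - f y i| <= e / 2.
    apply: (@filter_forall _ _ (fun i y => K y -> `|f x i - f y i| <= e / 2) _
      (nbhs_filter x)) => i.
    by move/cvgrPdist_le : (cf x i Kx) => /(_ _ e20).
  move=> /nbhs_ballP[d /= d0 dP].
  have d20 : 0 < d / 2 by rewrite divr_gt0.
  exists (ball x (d / 2), [set r | r < d / 2]).
    split; first exact: nbhsx_ballx.
    exact: nbhs_right_lt.
  move=> [y r] /= [xy rd] Ky t Kt ytr i.
  have xyd : ball x d y by apply: le_ball xy; rewrite ler_pdivrMr// ler_peMr// ?ler1n// ltW.
  have xtd : ball x d t.
    rewrite [d]splitr; apply: ball_triangle xy _.
    exact: lt_trans ytr rd.
  rewrite -(subrKA (f x i)) (le_trans (ler_normD _ _))// [leRHS]splitr.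
  apply: lerD; last exact: dP.
  by rewrite distrC; exact: dP.
exists (d / 2); first by rewrite divr_gt0.
move=> s t Ks Kt std; apply: (dP (d / 2)) => //=; last by rewrite divr_gt0.
by rewrite sub0r normrN gtr0_norm ?divr_gt0// ltr_pdivrMr// ltr_pMr// ltr1n.
Qed.

Lemma ae_le_Rintegral (D : set R) (f g : R -> R) :
  measurable D -> mu.-integrable D (EFin \o f) -> mu.-integrable D (EFin \o g) ->
  (\forall x \ae mu, D x -> f x <= g x) ->
  \int[mu]_(x in D) f x <= \int[mu]_(x in D) g x.
Proof.
move=> mD intf intg fg; rewrite -subr_ge0 -RintegralB//.
have int_gf := integrable_subr mD intg intf.
have mgf : measurable_fun D (fun x => g x - f x).
  by apply/measurable_EFinP; exact: measurable_int int_gf.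
rewrite /Rintegral (@ae_eq_integral _ _ _ mu D (EFin \o (fun x => `|g x - f x|))) //.
- by apply: Rintegral_ge0.
- exact/measurable_EFinP.
- by apply/measurable_EFinP; exact: measurableT_comp.
- apply: (@filterS _ _ (ae_filter_ringOfSetsType mu) _ _ _ fg) => x fgx Dx /=.
  by rewrite ger0_norm// subr_ge0; exact: fgx.
Qed.

End gronwall.

(** * Node functions on a weighted graph *)

Section graph.
Context {R : realType} {V : finType}.
Variables (G : weighted_graph R V) (r : R).
Local Notation mu := (@lebesgue_measure R).
Local Notation dr i := (degree (weight G) i `^ r).
Implicit Types (u v w c : V -> R).

Lemma degree_powR_gt0 (i : V) : 0 < dr i.
Proof. by rewrite powR_gt0// degree_gt0. Qed.

Lemma weight_ge0 i j : 0 <= weight G i j.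
Proof.
have [ij|ij] := boolP (edge G i j); first exact/ltW/weight_edge.
by rewrite weight_nonedge.
Qed.

Lemma innerVBl u v c : innerV G r (u - v) c = innerV G r u c - innerV G r v c.
Proof.
by rewrite /innerV -sumrB; apply: eq_bigr => i _; rewrite -!mulrBl.
Qed.

Lemma innerV_ge0 u : 0 <= innerV G r u u.
Proof.
by apply: sumr_ge0 => i _; rewrite -expr2 mulr_ge0 ?sqr_ge0// ltW// degree_powR_gt0.
Qed.

Lemma sqr_normV u : normV G r u ^+ 2 = innerV G r u u.
Proof. by rewrite sqr_sqrtr// innerV_ge0. Qed.

Lemma sqr_coord_le u i : u i ^+ 2 * dr i <= innerV G r u u.
Proof.
rewrite /innerV (bigD1 i)//= -expr2 lerDl; apply: sumr_ge0 => j _.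
by rewrite -expr2 mulr_ge0 ?sqr_ge0// ltW// degree_powR_gt0.
Qed.

Lemma coord_le_normV u i : `|u i| * Num.sqrt (dr i) <= normV G r u.
Proof.
rewrite -sqrtr_sqr -sqrtrM ?sqr_ge0//; apply: ler_wsqrtr; exact: sqr_coord_le.
Qed.

(** Exchanging the two summation indices shows that twice this inner product is
    the sum of the w_ij (u_i - u_j)^2. *)
Lemma laplacian_ge0 u : 0 <= innerV G r (laplacian G r u) u.
Proof.
have -> : innerV G r (laplacian G r u) u =
    \sum_i \sum_j weight G i j * (u i - u j) * u i.
  apply: eq_bigr => i _; rewrite /laplacian powRN -big_distrl/=.
  by rewrite mulrAC [_ * dr i]mulrAC mulVf ?mul1r// gt_eqF// degree_powR_gt0.
set S := \sum_i _.
have SE : S = \sum_i \sum_j weight G i j * (u j - u i) * u j.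
  rewrite /S exchange_big/=; apply: eq_bigr => i _; apply: eq_bigr => j _.
  by rewrite weight_sym.
rewrite -(pmulr_rge0 _ (ltr0Sn R 1)) mulr_natl mulr2n {2}SE -big_split/=.
apply: sumr_ge0 => i _; rewrite -big_split/=; apply: sumr_ge0 => j _.
rewrite (_ : _ + _ = weight G i j * (u i - u j) ^+ 2); last by ring.
by rewrite mulr_ge0 ?weight_ge0// sqr_ge0.
Qed.

(** If u_i < v_i then u_i < 1 and v_i > 0, which forces bu_i >= 0 >= bv_i; the
    case u_i > v_i is symmetric. *)
Lemma subdiffB_monotone u v (bu bv : V -> R) :
  (forall i, 0 <= u i <= 1) -> (forall i, 0 <= v i <= 1) ->
  subdiffB u bu -> subdiffB v bv -> innerV G r (bu - bv) (u - v) <= 0.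
Proof.
move=> u01 v01 ubu vbv; rewrite -oppr_ge0 /innerV -sumrN.
apply: sumr_ge0 => i _; rewrite -mulNr mulr_ge0 ?(ltW (degree_powR_gt0 _))//.
rewrite oppr_ge0 !fctE.
have [u0 ui u1] := ubu i; have [v0 vi v1] := vbv i.
have /andP[u0' u1'] := u01 i; have /andP[v0' v1'] := v01 i.
have sgn_lt (x b : R) : 0 <= x -> x < 1 -> (x = 0 -> 0 <= b) ->
    (0 < x < 1 -> b = 0) -> 0 <= b.
  move=> x0 x1 b0 b1; have [/eqP/b0//|xn0] := boolP (x == 0).
  by rewrite b1// lt_neqAle eq_sym xn0 x0.
have sgn_gt (x b : R) : 0 < x -> x <= 1 -> (x = 1 -> b <= 0) ->
    (0 < x < 1 -> b = 0) -> b <= 0.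
  move=> x0 x1 b0 b1; have [/eqP/b0//|xn0] := boolP (x == 1).
  by rewrite b1// x0 lt_neqAle xn0 x1.
have [uv|vu|->] := ltgtP (u i) (v i).
- rewrite mulr_ge0_le0 ?subr_le0 ?(ltW uv)// subr_ge0.
  apply: (@le_trans _ _ 0).
    exact: (sgn_gt (v i) _ (le_lt_trans u0' uv)).
  exact: (sgn_lt (u i) _ _ (lt_le_trans uv v1')).
- rewrite mulr_le0_ge0 ?subr_ge0 ?(ltW vu)// subr_le0.
  apply: (@le_trans _ _ 0).
    exact: (sgn_gt (u i) _ (le_lt_trans v0' vu)).
  exact: (sgn_lt (v i) _ _ (lt_le_trans vu u1')).
- by rewrite subrr mulr0.
Qed.

Lemma AC_energy_ineq (eps : R) u v (du dv bu bv : V -> R) : 0 < eps ->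
  (forall i, 0 <= u i <= 1) -> (forall i, 0 <= v i <= 1) ->
  (forall i, eps * du i + eps * laplacian G r u i + 2^-1 - u i = bu i) ->
  (forall i, eps * dv i + eps * laplacian G r v i + 2^-1 - v i = bv i) ->
  subdiffB u bu -> subdiffB v bv ->
  innerV G r (du - dv) (u - v) <= innerV G r (u - v) (u - v) / eps.
Proof.
move=> eps0 u01 v01 eu ev ubu vbv.
have mono := subdiffB_monotone u01 v01 ubu vbv.
have lap := laplacian_ge0 (u - v).
have E : innerV G r (bu - bv) (u - v) = eps * innerV G r (du - dv) (u - v) +
    eps * innerV G r (laplacian G r (u - v)) (u - v) - innerV G r (u - v) (u - v).
  rewrite /innerV !mulr_sumr -big_split/= -sumrB; apply: eq_bigr => i _.
  have -> : laplacian G r (u - v) i = laplacian G r u i - laplacian G r v i.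
    rewrite /laplacian -mulrBr -sumrB; congr (_ * _); apply: eq_bigr => j _.
    by rewrite !fctE; ring.
  by rewrite !fctE -eu -ev; ring.
rewrite ler_pdivlMr// mulrC.
have : 0 <= eps * innerV G r (laplacian G r (u - v)) (u - v).
  by rewrite mulr_ge0// ltW.
by move: mono; rewrite E; lra.
Qed.

(** On a bounded interval square integrability implies integrability, by
    |x| <= x^2 + 1. *)
Lemma L2_integrable (a b : R) (f : R -> V -> R) i :
  L2 G r `]a, b[ f -> mu.-integrable `]a, b[ (EFin \o (fun t => f t i)).
Proof.
move=> [mf f2].
have mf2 : measurable_fun `]a, b[ (fun t => normV G r (f t) ^+ 2).
  rewrite (_ : (fun t => _) =
    (fun t => \sum_i f t i * f t i * dr i)); last first.
    by apply/funext => t; rewrite sqr_normV.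
  apply: measurable_sum => j; apply: measurable_funM => //.
  by apply: measurable_funM; exact: mf.
have intf2 : mu.-integrable `]a, b[ (EFin \o (fun t => normV G r (f t) ^+ 2)).
  apply/integrableP; split; first exact/measurable_EFinP.
  apply: le_lt_trans f2; rewrite le_eqVlt; apply/orP; left; apply/eqP.
  by apply: eq_integral => t _; rewrite /= ger0_norm// sqr_ge0.
have int1 : mu.-integrable `]a, b[ (EFin \o cst (1 : R)).
  by apply: continuous_integrable_itvoo => x; exact: cst_continuous.
have intg := integrable_addr (measurable_itv _)
  (integrable_scaler (dr i)^-1 (measurable_itv _) intf2) int1.
apply: le_integrable intg => //; first by apply/measurable_EFinP; exact: mf.
move=> t _; rewrite /= lee_fin [leRHS]ger0_norm; last first.
  by rewrite addr_ge0// mulr_ge0 ?sqr_ge0// invr_ge0 ltW// degree_powR_gt0.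
have m0 := degree_powR_gt0 i.
rewrite sqr_normV (@le_trans _ _ (f t i ^+ 2 + 1))//; last first.
  rewrite lerD2r mulrC ler_pdivlMr//; exact: sqr_coord_le.
rewrite -real_normK ?num_real//.
have := sqr_ge0 (`|f t i| - 1); rewrite sqrrB1 => ?.
have := normr_ge0 (f t i); lra.
Qed.

Lemma integrable_innerV (a b : R) (f : R -> V -> R) c : L2 G r `]a, b[ f ->
  mu.-integrable `]a, b[ (EFin \o (fun t => innerV G r (f t) c)).
Proof.
move=> f2; apply: integrable_sumr => // i.
rewrite (_ : (fun x => _) = (fun x => (c i * dr i) * f x i)); last first.
  by apply/funext => x; ring.
by apply: integrable_scaler => //; exact: L2_integrable.
Qed.

Lemma C0_coord (T : set R) (u : R -> V -> R) t i : C0 G r T u -> T t ->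
  u s i @[s --> within T (nbhs t)] --> u t i.
Proof.
move=> uC Tt; have m0 : 0 < Num.sqrt (dr i) by rewrite sqrtr_gt0 degree_powR_gt0.
apply/cvgrPdist_le => e e0.
move/cvgrPdist_le : (uC t Tt) => /(_ _ (mulr_gt0 e0 m0)).
apply: filterS => s; rewrite sub0r normrN ger0_norm ?sqrtr_ge0// => us.
rewrite distrC -(ler_pM2r m0); apply: le_trans us.
exact: (coord_le_normV (u s - u t)).
Qed.

(** A scalar bump times a constant vector is an admissible test function, which
    reduces the vector-valued weak derivative to the scalar one. *)
Lemma smooth_test_function (a b a' b' : R) phi c :
  smooth phi -> a < a' -> b' < b -> (forall x, phi x != 0 -> a' <= x <= b') ->
  test_function `]a, b[ (fun t i => phi t * c i : R).
Proof.
move=> sphi aa' bb' supp.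
have clS : closure [set t | exists i : V, phi t * c i != 0] `<=` `[a', b'].
  apply: (@subset_trans _ (closure (`[a', b'] : set R))); last exact: itv_closed.
  apply: closure_subset => t /= [i].
  by rewrite mulf_eq0 negb_or in_itv/= => /andP[/supp].
split.
- move=> i n t; apply: smooth_derivable => k.
  by apply: ntimes_derivableM; [exact: sphi|exact: ntimes_derivable_cst].
- apply: (subclosed_compact _ (@segment_compact R a' b') clS).
  exact: closed_closure.
- move=> t /clS /=; rewrite !in_itv/=; lra.
Qed.

(** Pairing with a constant vector turns u into a scalar function with a weak
    derivative and with limits at both ends of the interval. *)
Lemma Rintegral_innerV_derivative (a b : R) (T : set R) (u du : R -> V -> R) c :
  a < b -> `[a, b] `<=` T -> C0 G r T u -> H1_with G r `]a, b[ u du ->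
  \int[mu]_(t in `]a, b[) innerV G r (du t) c =
  innerV G r (u b) c - innerV G r (u a) c.
Proof.
move=> ab abT uC [u2 du2 weak].
have cvg_inner t (F : set_system R) : Filter F -> T t ->
    (forall i, u s i @[s --> F] --> u t i) ->
    innerV G r (u s) c @[s --> F] --> innerV G r (u t) c.
  move=> FF Tt uF; apply: cvg_big => [|i _]; first exact: add_continuous.
  by apply: cvgMr_tmp; apply: cvgMr_tmp.
have Ta : T a by apply: abT; rewrite /= in_itv/= lexx ltW.
have Tb : T b by apply: abT; rewrite /= in_itv/= lexx ltW.
apply: (Rintegral_weak_derivative ab (integrable_innerV c u2)) => //.
- exact: integrable_innerV.
- apply: cvg_inner => // i W /(C0_coord uC Ta) WT.
  have {}WT : \forall s \near a, T s -> W (u s i) := WT.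
  suff : \forall s \near a, a < s -> W (u s i) by [].
  apply: filterS2 WT (lt_nbhsl ab) => s Ws sb as_; apply: Ws; apply: abT.
  by rewrite /= in_itv/= !ltW.
- apply: cvg_inner => // i W /(C0_coord uC Tb) WT.
  have {}WT : \forall s \near b, T s -> W (u s i) := WT.
  suff : \forall s \near b, s < b -> W (u s i) by [].
  apply: filterS2 WT (lt_nbhsr ab) => s Ws sa sb; apply: Ws; apply: abT.
  by rewrite /= in_itv/= !ltW.
- move=> phi a' b' sphi aa' bb' supp.
  have := weak _ (smooth_test_function c sphi aa' bb' supp).
  have dphi i t : derive1 (fun s => phi s * c i) t = derive1 phi t * c i.
    by rewrite derive1Mr//; exact: (sphi 1).1.
  rewrite (_ : (fun t => innerV G r (u t) _) =
    (fun t => innerV G r (u t) c * derive1 phi t)); last first.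
    apply/funext => t; rewrite /innerV mulr_suml; apply: eq_bigr => i _.
    by rewrite /deriv_t dphi; ring.
  rewrite (_ : (fun t => innerV G r (du t) _) =
    (fun t => innerV G r (du t) c * phi t))//.
  apply/funext => t; rewrite /innerV mulr_suml; apply: eq_bigr => i _.
  by ring.
Qed.

End graph.

(** * Growth of the squared distance of two solutions *)

Section energy.
Context {R : realType} {V : finType}.
Variables (G : weighted_graph R V) (r : R).
Local Notation mu := (@lebesgue_measure R).
Local Notation dr i := (degree (weight G) i `^ r).

Definition total_measure : R := \sum_i dr i.

Definition normL1 (f : V -> R) : R := \sum_i `|f i| * dr i.

Lemma innerVDr (f g h : V -> R) :
  innerV G r f (g + h) = innerV G r f g + innerV G r f h.
Proof.
by rewrite /innerV -big_split; apply: eq_bigr => i _ /=; rewrite -mulrDl -mulrDr.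
Qed.

Lemma innerV_le_normL1 (e : R) (f g : V -> R) :
  (forall i, `|g i| <= e) -> innerV G r f g <= e * normL1 f.
Proof.
move=> ge; rewrite /innerV /normL1 mulr_sumr; apply: ler_sum => i _.
rewrite mulrA; apply: ler_wpM2r; first exact/ltW/degree_powR_gt0.
apply: le_trans (ler_norm _) _; rewrite normrM mulrC.
by rewrite ler_wpM2r.
Qed.

(** |f|^2 - |g|^2 factors as <f - g, f + g>, and |f_i + g_i| <= 2. *)
Lemma innerV_le_osc (e : R) (f g : V -> R) :
  (forall i, `|f i| <= 1) -> (forall i, `|g i| <= 1) ->
  (forall i, `|f i - g i| <= e) ->
  innerV G r f f <= innerV G r g g + e * (2 * total_measure).
Proof.
move=> f1 g1 fg; rewrite /innerV /total_measure mulrA mulr_sumr -big_split/=.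
apply: ler_sum => i _; rewrite -mulrDl; apply: ler_wpM2r; first exact/ltW/degree_powR_gt0.
have fgE : f i * f i = g i * g i + (f i - g i) * (f i + g i) by ring.
rewrite fgE lerD2l; apply: le_trans (ler_norm _) _; rewrite normrM ler_pM//.
by apply: le_trans (ler_normD _ _) _; rewrite [leRHS](_ : 2 = 1 + 1)// lerD.
Qed.

Lemma integrable_normL1 (a b : R) (f : R -> V -> R) :
  (forall i, mu.-integrable `]a, b[ (EFin \o (fun t => f t i))) ->
  mu.-integrable `]a, b[ (EFin \o (fun t => normL1 (f t))).
Proof.
move=> intf; apply: integrable_sumr => // i.
rewrite (_ : (fun x => _) = (fun x => dr i * `|f x i|)); last first.
  by apply/funext => x; rewrite mulrC.
by apply: integrable_scaler => //; exact: integrable_normr.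
Qed.

(** One Euler step for the squared distance of two solutions. Exactness for
    F(b) - F(a) comes from the constant vector c = w(b) + w(a); the oscillation
    bound e replaces c by 2 w(s) under the integral, where the energy
    inequality applies. The same bound gives F(s) <= F(a) + 2 e total_measure,
    whence the term with 4 / eps = 2 * (2 / eps). *)
Lemma energy_growth (eps e a b : R) (T : set R) (u v du dv : R -> V -> R) :
  let w s := u s - v s in
  0 < eps -> a < b -> `[a, b] `<=` T ->
  (forall t, T t -> forall i, 0 <= u t i <= 1) ->
  (forall t, T t -> forall i, 0 <= v t i <= 1) ->
  C0 G r T u -> C0 G r T v ->
  H1_with G r `]a, b[ u du -> H1_with G r `]a, b[ v dv ->
  (\forall s \ae mu, T s ->
     innerV G r (du s - dv s) (w s) <= innerV G r (w s) (w s) / eps) ->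
  (forall s t, `[a, b]%classic s -> `[a, b]%classic t -> forall i, `|w s i - w t i| <= e) ->
  innerV G r (w b) (w b) <= innerV G r (w a) (w a) +
    2 / eps * innerV G r (w a) (w a) * (b - a) +
    e * (4 / eps * total_measure * (b - a) +
         2 * \int[mu]_(s in `]a, b[) normL1 (du s - dv s)).
Proof.
move=> w eps0 ab abT u01 v01 uC vC uH vH energy osc.
have aab : `[a, b]%classic a by rewrite /= in_itv/= lexx ltW.
have bab : `[a, b]%classic b by rewrite /= in_itv/= lexx ltW.
have w1 s i : `[a, b]%classic s -> `|w s i| <= 1.
  move=> /abT Ts; rewrite /w !fctE ler_norml.
  by have := u01 _ Ts i; have := v01 _ Ts i; lra.
set F := fun s => innerV G r (w s) (w s).
rewrite -/(F a) -/(F b).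
pose c := w b + w a.
have [_ du2 _] := uH; have [_ dv2 _] := vH.
have intu := integrable_innerV c du2; have intv := integrable_innerV c dv2.
have increment : F b - F a =
    \int[mu]_(s in `]a, b[) innerV G r (du s - dv s) c.
  transitivity (\int[mu]_(s in `]a, b[) (innerV G r (du s) c - innerV G r (dv s) c)).
    rewrite RintegralB// (Rintegral_innerV_derivative _ ab abT uC uH).
    rewrite (Rintegral_innerV_derivative _ ab abT vC vH) /F /c /innerV -!sumrB.
    by apply: eq_bigr => i _; rewrite /w !fctE; ring.
  by apply: eq_Rintegral => s _; rewrite innerVBl.
have int_cst (x : R) : mu.-integrable `]a, b[ (EFin \o cst x).
  by apply: continuous_integrable_itvoo => y; exact: cst_continuous.
have intN : mu.-integrable `]a, b[ (EFin \o (fun s => normL1 (du s - dv s))).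
  apply: integrable_normL1 => i.
  exact: (integrable_subr (measurable_itv _) (L2_integrable i du2)
    (L2_integrable i dv2)).
pose bound := 2 / eps * (F a + e * (2 * total_measure)).
have upper : F b - F a <=
    \int[mu]_(s in `]a, b[) (bound + 2 * e * normL1 (du s - dv s)).
  rewrite increment; apply: ae_le_Rintegral => //.
  - have := integrable_subr (measurable_itv _) intu intv.
    congr (_.-integrable _ _); apply/funext => s /=; by rewrite innerVBl.
  - exact: (integrable_addr (measurable_itv _) (int_cst bound)
      (integrable_scaler (2 * e) (measurable_itv _) intN)).
  apply: (@filterS _ _ (ae_filter_ringOfSetsType mu) _ _ _ energy) => s sE sab.
  have sab' : `[a, b]%classic s by exact: subset_itv_oo_cc sab.
  have {}sE := sE (abT _ sab').
  (* c = 2 w(s) + a remainder with coordinates bounded by 2 e *)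
  rewrite (_ : c = (w s + w s) + (w b - w s + (w a - w s))); last first.
    by apply/funext => i; rewrite /c !fctE; ring.
  rewrite innerVDr lerD//.
    rewrite innerVDr.
    have Fsa : F s <= F a + e * (2 * total_measure).
      apply: innerV_le_osc => i; [exact: w1|exact: w1|exact: osc].
    apply: (@le_trans _ _ (2 * (F s / eps))).
      by rewrite mulr_natl mulr2n lerD.
    by rewrite /bound -mulrA ler_pM2l// mulrC ler_pM2l// invr_gt0.
  apply: innerV_le_normL1 => i; rewrite (le_trans (ler_normD _ _))//.
  by rewrite mulr_natl mulr2n lerD// osc.
move: upper.
rewrite RintegralD//; last 2 first.
- exact: (int_cst bound).
- exact: (integrable_scaler (2 * e) (measurable_itv _) intN).
rewrite RintegralZl// (_ : \int[mu]_(s in `]a, b[) bound = bound * (b - a)).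
  by rewrite /bound; lra.
rewrite Rintegral_cst//; congr (_ * _).
by have /(congr1 fine) := lebesgue_measure_itv `]a, b[; rewrite /= lte_fin ab.
Qed.

End energy.

Unset Implicit Arguments.
Set Strict Implicit.

(** * Exponential stability *)

Theorem theorem3p8 (R : realType) (V : finType) (G : weighted_graph R V)
  (r eps : R) (hr : 0 <= r <= 1) (heps : 0 < eps)
  (T : set R)
  (hT : (exists T0 : R, 0 < T0 /\ T = [set` `[0, T0]]) \/ T = [set` `[0, +oo[])
  (u v : R -> V -> R)
  (hu : AC_solution G r eps T u) (hv : AC_solution G r eps T v) :
  forall t : R, T t ->
    normV G r (u t - v t) <= expR (t / eps) * normV G r (u 0 - v 0).
Proof.
pose mu := @lebesgue_measure R.
have T0 : T 0.
  by case: hT => [[T0 [T00 ->]]|->]; rewrite /= in_itv/= lexx// ltW.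
have Tge0 t : T t -> 0 <= t.
  by case: hT => [[? [_ ->]]|->]; rewrite /= in_itv/= => /andP[].
have Tconvex a b : T a -> T b -> `[a, b] `<=` T.
  case: hT => [[? [_ ->]]|->] /=; rewrite !in_itv/= => aT bT x;
    rewrite /= !in_itv/=; lra.
have [bu [u01 _ uC [du uH eu]]] := hu.
have [bv [v01 _ vC [dv vH ev]]] := hv.
move=> t Tt; have := Tge0 t Tt; rewrite le_eqVlt => /predU1P[<-|t0].
  by rewrite mul0r expR0 mul1r.
pose F s := innerV G r (u s - v s) (u s - v s).
have energy : \forall s \ae mu, T s ->
    innerV G r (du s - dv s) (u s - v s) <= F s / eps.
  apply: (@filterS2 _ _ (ae_filter_ringOfSetsType mu) _ _ _ _ eu ev) => s us vs Ts.
  have [us1 us2] := us Ts; have [vs1 vs2] := vs Ts.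
  exact: AC_energy_ineq (u01 s Ts) (v01 s Ts) us1 vs1 us2 vs2.
pose N s := normL1 G r (du s - dv s).
have N0 s : 0 <= N s.
  by apply: sumr_ge0 => i _; rewrite mulr_ge0// powR_ge0.
have D0 : 0 <= total_measure G r by apply: sumr_ge0 => i _; exact: powR_ge0.
have intN : mu.-integrable `]0, t[ (EFin \o N).
  have [_ du2 _] := uH _ _ T0 Tt t0; have [_ dv2 _] := vH _ _ T0 Tt t0.
  apply: integrable_normL1 => i.
  exact: (integrable_subr (measurable_itv _) (L2_integrable i du2)
    (L2_integrable i dv2)).
(* M collects the coefficient of e in the one-step estimate, so that M b - M a
   is that coefficient on ]a, b[ *)
pose M s := 4 / eps * total_measure G r * s + 2 * \int[mu]_(x in `]0, s[) N x.
have ME a b : 0 <= a -> a <= b -> b <= t ->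
    M b - M a = 4 / eps * total_measure G r * (b - a)
                + 2 * \int[mu]_(x in `]a, b[) N x.
  move=> a0 ab bt.
  have intNb : mu.-integrable `]0, b[ (EFin \o N).
    by apply: integrableS intN => //; apply: subset_itvl; rewrite bnd_simp.
  have intNa : mu.-integrable `]0, a[ (EFin \o N).
    by apply: integrableS intNb => //; apply: subset_itvl; rewrite bnd_simp.
  have [->|ab'] := eqVneq a b.
    by rewrite !subrr set_itvoo0 Rintegral_set0 !mulr0 addr0.
  have := Rintegral_itvB (a := BRight 0) (b := BLeft b) (x := a) intNb.
  rewrite !bnd_simp lt_neqAle ab' => /(_ a0 ab) <-.
  by rewrite -(Rintegral_itv_bndo_bndc intNa) /M; ring.
have : F t <= expR (2 / eps * t) * F 0.
  apply: (@le_expR_of_local_growth _ _ _ _ M) => //.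
  - by rewrite divr_ge0// ltW.
  - by move=> s; exact: innerV_ge0.
  - move=> a b a0 ab bt; rewrite -subr_ge0 ME// addr_ge0//.
      by rewrite mulr_ge0 ?subr_ge0// mulr_ge0// divr_ge0// ltW.
    by rewrite mulr_ge0// Rintegral_ge0.
  move=> e e0.
  have [|d d0 osc] := @uniform_continuity_compact _ _ `[0, t] e
      (fun s i => (u s - v s) i) (@segment_compact _ _ _) e0.
    move=> x i x0t; have Tx : T x by exact: Tconvex T0 Tt _ x0t.
    have sub := within_subset (nbhs_filter x) (Tconvex _ _ T0 Tt).
    by apply: cvgB; apply: cvg_trans (cvg_app _ sub) _;
      [exact: C0_coord uC Tx|exact: C0_coord vC Tx].
  exists d => // a b a0 ab bt bad.
  rewrite ME ?(ltW ab)//.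
  have abt : `[a, b] `<=` `[0, t].
    by move=> x /=; rewrite !in_itv/=; lra.
  have Tab : `[a, b] `<=` T by apply: subset_trans abt (Tconvex _ _ T0 Tt).
  have Ta : T a by apply: Tab; rewrite /= in_itv/= lexx ltW.
  have Tb : T b by apply: Tab; rewrite /= in_itv/= lexx ltW.
  apply: (energy_growth heps ab Tab u01 v01 uC vC (uH _ _ Ta Tb ab)
    (vH _ _ Ta Tb ab) energy).
  move=> x y xab yab i; apply: osc; [exact: abt|exact: abt|].
  move: xab yab; rewrite /= !in_itv/= ltr_norml; lra.
move=> Ft; rewrite -(ler_pXn2r (n := 2))// ?nnegrE ?sqrtr_ge0 ?mulr_ge0
  ?expR_ge0 ?sqrtr_ge0//.
rewrite exprMn !sqr_normV -expRM_natl.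
by rewrite (_ : 2%:R * (t / eps) = 2 / eps * t)//; ring.
Qed.
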